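(* Let $X\subset N_{\mathbb R}$ be a balanced polyhedral space and let $\gamma\in\mathrm{PAPC}(X)$ be positive at infinity. If $X$ is one-dimensional and polyhedrally smooth, then $(X,\gamma)$ has the orthogonality property.
   Context: Polyhedral spaces. $N$ is a lattice (free abelian group of finite rank), $M=\mathrm{Hom}(N,\mathbb Z)$, $N_R=N\otimes R$. A rational polyhedron in $N_{\mathbb R}$ is a subset defined by finitely many conditions $f(n)+b=0$ or $f(n)+b\ge 0$ with $f\in M$, $b\in\mathbb Z$. For a polyhedron $\sigma$: $N_{\sigma,\mathbb R}$ is the linear span of all $x-y$, $x,y\in\sigma$; $N_\sigma=N_{\sigma,\mathbb R}\cap N$; $M_\sigma$ is the dual lattice; $\mathrm{rec}(\sigma)=\{v: x+tv\in\sigma\ \forall x\in\sigma,t\ge0\}$. A rational polyhedral complex $\Pi$ is a finite collection of rational polyhedra (its faces), closed under taking faces, two of which meet in the empty set or in a common face; $|\Pi|$ is its support, $\Pi^{(k)}$ its set of $k$-dimensional faces, $\tau\prec\sigma$ means $\tau$ is a face of $\sigma$. A one-dimensional polyhedral space is a set $X=|\Pi|$ where all inclusion-maximal faces of $\Pi$ have dimension $1$; any rational polyhedral complex with support $X$ is called a polyhedral structure on $X$. Balancing and smoothness. For an edge $e\in\Pi^{(1)}$ adjacent to a vertex $v\in\Pi^{(0)}$, $n_{e/v}\in N_e$ is the primitive vector pointing from $v$ into $e$. A balanced one-dimensional polyhedral space carries weights $[X](e)\in\mathbb Q_{>0}$ on the edges of some polyhedral structure (transported to refinements by restriction) with $\sum_{e\succ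 v}[X](e)n_{e/v}=0$ at each vertex $v$. $X$ is polyhedrally smooth if for every polyhedral structure $\Pi$ on which $[X]$ is defined and every $v\in\Pi^{(0)}$, $\mathrm{Span}_{\mathbb Z}(n_{e/v}: e\succ v)$ is a saturated sublattice of $N$ of rank $\mathrm{val}(v)-1$, where $\mathrm{val}(v)$ is the number of edges adjacent to $v$. Functions. A continuous $\phi:X\to\mathbb R$ is piecewise affine on $\Pi$ if on each $\sigma\in\Pi$ it is the restriction of an affine function with linear part $\phi_\sigma\in M_\sigma\otimes\mathbb Q$ and rational constant term; $\mathrm{PA}(\Pi)$ is the set of these, $\mathrm{PA}(X)=\bigcup_\Pi\mathrm{PA}(\Pi)$. $\gamma\in\mathrm{PA}(\Pi)$ is positive at infinity if $\gamma_\sigma(v)>0$ for every $\sigma\in\Pi$ and non-zero $v\in\mathrm{rec}(\sigma)$. A polyhedral convex combination in $X$ is a triple $(x,(x_i)_{i\in I},(\alpha_i)_{i\in I})$ with $I$ finite, $x_i\in X\cap N_{\mathbb Q}$, $\alpha_i\in[0,1]$, $\sum\alpha_i=1$, $x=\sum\alpha_ix_i\in X$, such that for some polyhedral structure $\Pi$ there are faces $\tau,\sigma_i\in\Pi$ with $x\in\tau$, $x_i\in\sigma_i$, and $\tau$ a (not necessarily proper) face of every $\sigma_i$. $\mathrm{PC}(X)$ is the set of continuous $\phi:X\to\mathbb R$ with $\phi(x)\le\sum\alpha_i\phi(x_i)$ for all such combinations; $\mathrm{PAPC}(X)=\mathrm{PA}(X)\cap\mathrm{PC}(X)$; $\mathrm{PAPC}(X,\gamma)$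 is the subset of $\phi$ with $\phi-\gamma$ bounded. Monge--Ampère in dimension one. For $\phi\in\mathrm{PA}(\Pi)$, with $[X]$ defined on $\Pi$, $\mathrm{MA}_{\mathrm{poly}}(\phi)=\sum_{v\in\Pi^{(0)}}\Big(\sum_{e\succ v}[X](e)\phi_e(n_{e/v})\Big)\delta_v$. Envelope and orthogonality. For $u$ continuous on $X$, $P_\gamma(u)(x)=\sup\{\psi(x):\psi\in\mathrm{PC}(X),\ \psi\le\gamma+u,\ \psi\le\gamma+O(1)\}$. In dimension one, $P_\gamma(u)\in\mathrm{PAPC}(X,\gamma)$ for every bounded $u\in\mathrm{PA}(X)$. $(X,\gamma)$ has the orthogonality property if for every bounded $u\in\mathrm{PA}(X)$, $\int_X\big(P_\gamma(u)-(\gamma+u)\big)\,\mathrm{MA}_{\mathrm{poly}}(P_\gamma(u))=0$. *)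

(* Defs.v *)
From HB Require Import structures.
From mathcomp Require Import all_boot all_order all_algebra.
From mathcomp Require Import finmap.
From mathcomp Require Import all_classical all_reals all_analysis.

Set Implicit Arguments.
Unset Strict Implicit.
Unset Printing Implicit Defensive.

Import Order.TTheory GRing.Theory Num.Theory.
Import numFieldNormedType.Exports.

Local Open Scope classical_set_scope.
Local Open Scope ring_scope.

(* The lattice N is Z^n, i.e. 'rV[int]_n.  Its dual M is identified with      *)
(* 'rV[int]_n through [pairing], and N_Q, N_R, M_Q are the corresponding row  *)
(* vectors over rat and R.                                                    *)
(* Functions on a subset X of N_R are total functions 'rV[R]_n -> R of which  *)
(* only the values on X are ever used.                                        *)

Section Lattice.
Context {R : realType} {n : nat}.

Definition pairing {F : comNzRingType} (f x : 'rV[F]_n) : F :=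
  \sum_(i < n) f 0 i * x 0 i.

Definition ofZ {F : nzRingType} (p : 'rV[int]_n) : 'rV[F]_n :=
  map_mx intr p.

Definition ofQ (q : 'rV[rat]_n) : 'rV[R]_n := map_mx ratr q.

Definition is_linspan (A : set 'rV[R]_n) (U : {vspace 'rV[R]_n}) : Prop :=
  (forall x, A x -> x \in U) /\
  (forall W : {vspace 'rV[R]_n}, (forall x, A x -> x \in W) -> (U <= W)%VS).

(* The real linear span of A as a vspace; by [linspanP] the default value is  *)
(* never used.                                                                *)
Definition linspan (A : set 'rV[R]_n) : {vspace 'rV[R]_n} :=
  xget 0%VS [set U | is_linspan A U].

Lemma linspanP (A : set 'rV[R]_n) : is_linspan A (linspan A).
Proof.
have exU : exists U, is_linspan A U; last first.
  by case: exU => U HU; rewrite /linspan; case: xgetP => [V _ //|/(_ U)].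
pose inA (s : seq 'rV[R]_n) := forall x, x \in s -> A x.
pose P (k : nat) := `[< exists2 s, inA s & \dim (span s) = k >].
have P0 : exists k, P k.
  exists 0%N; apply/asboolP; exists [::]; first by move=> x; rewrite in_nil.
  by rewrite span_nil dimv0.
have Pub k : P k -> (k <= \dim {: 'rV[R]_n})%N.
  by move=> /asboolP[s _ <-]; apply/dimvS/subvf.
have [k /asboolP[s sA sk] kmax] := ex_maxnP P0 Pub.
exists (span s); split=> [x Ax|W AW]; last first.
  by apply/span_subvP => x /sA /AW.
have sub : (span s <= span (x :: s))%VS.
  by rewrite span_cons addvSr.
have le : (\dim (span (x :: s)) <= \dim (span s))%N.
  rewrite sk; apply: kmax; apply/asboolP; exists (x :: s) => //.
  by move=> y; rewrite inE => /orP[/eqP ->//|/sA].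
have /eqP -> : (span s == span (x :: s))%VS.
  by rewrite eqEdim sub le.
by rewrite memv_span // inE eqxx.
Qed.

Definition Zspan (A : set 'rV[int]_n) : set 'rV[int]_n :=
  [set p | exists s : seq (int * 'rV[int]_n),
     (forall c, c \in s -> A c.2) /\ p = \sum_(c <- s) c.1 *: c.2].

Definition saturated (L : set 'rV[int]_n) : Prop :=
  forall (k : int) (p : 'rV[int]_n), k != 0 -> L (k *: p) -> L p.

Definition lattice_rank (L : set 'rV[int]_n) : nat := \dim (linspan (ofZ @` L)).

End Lattice.

Section Polyhedra.
Context {R : realType} {n : nat}.
Local Notation NR := 'rV[R]_n.

Definition affZ (c : 'rV[int]_n * int) (x : NR) : R :=
  pairing (ofZ c.1) x + c.2%:~R.

Definition rational_polyhedron (sigma : set NR) : Prop :=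
  exists E I : seq ('rV[int]_n * int),
    sigma = [set x | (forall c, c \in E -> affZ c x = 0) /\
                     (forall c, c \in I -> 0 <= affZ c x)].

(* N_{sigma,R} *)
Definition dirspace (sigma : set NR) : {vspace NR} :=
  linspan [set z | exists x y, [/\ sigma x, sigma y & z = x - y]].

Definition dim (sigma : set NR) : nat := \dim (dirspace sigma).

Definition recession (sigma : set NR) : set NR :=
  [set v | forall x (t : R), sigma x -> 0 <= t -> sigma (x + t *: v)].

(* Faces are nonempty; f = 0 shows that sigma is a face of itself.            *)
Definition face (tau sigma : set NR) : Prop :=
  tau !=set0 /\
  exists f : 'rV[R]_n,
    tau = [set x | sigma x /\ forall y, sigma y -> pairing f x <= pairing f y].

Record polyhedral_complex (Pi : set (set NR)) : Prop := PolyhedralComplex {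
  pc_finite : finite_set Pi;
  pc_polyhedron : forall sigma, Pi sigma -> rational_polyhedron sigma;
  pc_nonempty : forall sigma, Pi sigma -> sigma !=set0;
  pc_face : forall sigma tau, Pi sigma -> face tau sigma -> Pi tau;
  pc_inter : forall sigma tau, Pi sigma -> Pi tau ->
    sigma `&` tau = set0 \/
    (face (sigma `&` tau) sigma /\ face (sigma `&` tau) tau) }.

Definition union_of_faces (Pi : set (set NR)) : set NR :=
  [set x | exists2 sigma, Pi sigma & sigma x].

Definition polyhedral_structure (X : set NR) (Pi : set (set NR)) : Prop :=
  polyhedral_complex Pi /\ union_of_faces Pi = X.

Definition one_dimensional (X : set NR) : Prop :=
  exists2 Pi, polyhedral_structure X Pi &
    forall sigma, Pi sigma ->
      (forall sigma', Pi sigma' -> sigma `<=` sigma' -> sigma' = sigma) ->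
      dim sigma = 1%N.

(* A nonempty polyhedron of dimension 0 is a singleton; vertices are          *)
(* represented by their unique point.                                         *)
Definition vertices (Pi : set (set NR)) : set NR := [set v | Pi [set v]].

Definition edges (Pi : set (set NR)) : set (set NR) :=
  [set e | Pi e /\ dim e = 1%N].

Definition edges_at (Pi : set (set NR)) (v : NR) : set (set NR) :=
  [set e | edges Pi e /\ face [set v] e].

Definition valency (Pi : set (set NR)) (v : NR) : nat :=
  #|` fset_set (edges_at Pi v)|%fset.

(* N_sigma *)
Definition sublattice (sigma : set NR) : set 'rV[int]_n :=
  [set p | ofZ p \in dirspace sigma].

Definition is_primitive_direction (v : NR) (e : set NR) (p : 'rV[int]_n) :
    Prop :=
  [/\ sublattice e p,
      p != 0,
      (forall (k : nat) (q : 'rV[int]_n),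
         sublattice e q -> p = q *+ k -> k = 1%N) &
      exists2 t : R, 0 < t & e (v + t *: ofZ p)].

(* n_{e/v} *)
Definition primitive_direction (v : NR) (e : set NR) : 'rV[int]_n :=
  xget 0 [set p | is_primitive_direction v e p].

Definition balanced_weight (Pi : set (set NR)) (w : set NR -> rat) : Prop :=
  (forall e, edges Pi e -> 0 < w e) /\
  (forall v, vertices Pi v ->
     \sum_(e \in edges_at Pi v)
        w e *: (ofZ (primitive_direction v e) : 'rV[rat]_n) = 0).

Definition refines (Pi' Pi : set (set NR)) : Prop :=
  [/\ polyhedral_complex Pi', polyhedral_complex Pi,
      union_of_faces Pi' = union_of_faces Pi &
      forall sigma', Pi' sigma' -> exists2 sigma, Pi sigma & sigma' `<=` sigma].

Definition restricts_to (Pi : set (set NR)) (w : set NR -> rat)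
    (Pi' : set (set NR)) (w' : set NR -> rat) : Prop :=
  refines Pi' Pi /\
  forall e' e, edges Pi' e' -> edges Pi e -> e' `<=` e -> w' e' = w e.

Definition balanced_structure (X : set NR) (Pi : set (set NR))
    (w : set NR -> rat) : Prop :=
  polyhedral_structure X Pi /\ balanced_weight Pi w.

(* The weight [X] is given by a pair (Pi0, w0), up to restriction to          *)
(* refinements.  [weight_on X Pi0 w0 Pi w] says that [X] is defined on Pi,    *)
(* where it is the weight w.                                                  *)
Definition weight_on (X : set NR) (Pi0 : set (set NR)) (w0 : set NR -> rat)
    (Pi : set (set NR)) (w : set NR -> rat) : Prop :=
  balanced_structure X Pi w /\
  exists Pi' w', restricts_to Pi0 w0 Pi' w' /\ restricts_to Pi w Pi' w'.

Definition polyhedrally_smooth (X : set NR) (Pi0 : set (set NR))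
    (w0 : set NR -> rat) : Prop :=
  forall Pi w, weight_on X Pi0 w0 Pi w ->
  forall v, vertices Pi v ->
    let L := Zspan (primitive_direction v @` edges_at Pi v) in
    saturated L /\ (lattice_rank (R := R) L).+1 = valency Pi v.

(* An element of M_sigma (x) Q is represented by a lift m to M_Q (M_Q maps    *)
(* onto M_sigma (x) Q since N_sigma is saturated); [linear_part] is only      *)
(* evaluated on N_{sigma,R}, where it does not depend on the lift.            *)
Definition affine_with (sigma : set NR) (phi : NR -> R)
    (m : 'rV[rat]_n) (c : rat) : Prop :=
  forall x, sigma x -> phi x = pairing (ofQ m) x + ratr c.

Definition linear_part (phi : NR -> R) (sigma : set NR) : 'rV[rat]_n :=
  xget 0 [set m | exists c, affine_with sigma phi m c].

Definition PA_on (Pi : set (set NR)) (phi : NR -> R) : Prop :=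
  {within union_of_faces Pi, continuous phi} /\
  forall sigma, Pi sigma -> exists m c, affine_with sigma phi m c.

Definition PA (X : set NR) (phi : NR -> R) : Prop :=
  exists2 Pi, polyhedral_structure X Pi & PA_on Pi phi.

Definition positive_at_infinity_on (Pi : set (set NR)) (gamma : NR -> R) :
    Prop :=
  PA_on Pi gamma /\
  forall sigma v, Pi sigma -> recession sigma v -> v != 0 ->
    0 < pairing (ofQ (linear_part gamma sigma)) v.

Definition positive_at_infinity (X : set NR) (gamma : NR -> R) : Prop :=
  exists2 Pi, polyhedral_structure X Pi & positive_at_infinity_on Pi gamma.

Definition convex_combination (X : set NR) (k : nat) (x : NR)
    (xs : 'I_k -> NR) (alpha : 'I_k -> R) : Prop :=
  [/\ X x,
      (forall i, X (xs i) /\ exists q, xs i = ofQ q),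
      (forall i, 0 <= alpha i <= 1) /\ \sum_(i < k) alpha i = 1,
      x = \sum_(i < k) alpha i *: xs i &
      exists (Pi : set (set NR)) (tau : set NR) (sigma : 'I_k -> set NR),
        [/\ polyhedral_structure X Pi,
            Pi tau, tau x &
            forall i, [/\ Pi (sigma i), sigma i (xs i) & face tau (sigma i)]]].

Definition PC (X : set NR) (phi : NR -> R) : Prop :=
  {within X, continuous phi} /\
  forall (k : nat) (x : NR) (xs : 'I_k -> NR) (alpha : 'I_k -> R),
    convex_combination X x xs alpha ->
    phi x <= \sum_(i < k) alpha i * phi (xs i).

Definition PAPC (X : set NR) (phi : NR -> R) : Prop := PA X phi /\ PC X phi.

(* MA_poly(phi) as a functional on functions: the point mass at v evaluates   *)
(* f at v.                                                                    *)
Definition MA_mass (Pi : set (set NR)) (w : set NR -> rat) (phi : NR -> R)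
    (v : NR) : rat :=
  \sum_(e \in edges_at Pi v)
     w e * pairing (linear_part phi e) (ofZ (primitive_direction v e)).

Definition MA_integral (Pi : set (set NR)) (w : set NR -> rat)
    (phi f : NR -> R) : R :=
  \sum_(v \in vertices Pi) ratr (MA_mass Pi w phi v) * f v.

(* P_gamma(u) *)
Definition envelope (X : set NR) (gamma u : NR -> R) (x : NR) : R :=
  sup [set y | exists psi : NR -> R,
    [/\ PC X psi,
        (forall z, X z -> psi z <= gamma z + u z),
        (exists C : R, forall z, X z -> psi z <= gamma z + C) &
        y = psi x]].

Definition bounded_on (X : set NR) (u : NR -> R) : Prop :=
  exists C : R, forall x, X x -> `|u x| <= C.

(* In dimension one the envelope P_gamma(u) of a bounded u in PA(X) is again  *)
(* piecewise affine, so that MA_poly(P_gamma(u)) is defined.  As the integral *)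
(* is invariant under refinement, it is required to vanish on every structure *)
(* Pi on which MA_poly(P_gamma(u)) can be computed.                           *)
Definition orthogonality_property (X : set NR) (Pi0 : set (set NR))
    (w0 : set NR -> rat) (gamma : NR -> R) : Prop :=
  forall u : NR -> R, PA X u -> bounded_on X u ->
  forall Pi w, weight_on X Pi0 w0 Pi w -> PA_on Pi (envelope X gamma u) ->
    MA_integral Pi w (envelope X gamma u)
      (fun x => envelope X gamma u x - (gamma x + u x)) = 0.

End Polyhedra.

(* Main.v *)
Require Import Defs.
From HB Require Import structures.
From mathcomp Require Import all_boot all_order all_algebra.
From mathcomp Require Import finmap ring lra zify.
From mathcomp Require Import all_classical all_reals all_analysis.

Import Order.TTheory GRing.Theory Num.Theory.
Import numFieldNormedType.Exports.

Set Implicit Arguments.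
Unset Strict Implicit.
Unset Printing Implicit Defensive.

Local Open Scope classical_set_scope.
Local Open Scope ring_scope.

(** Let [P] be the envelope and [v] a vertex.  The integrand at [v] vanishes
    when [P v = gamma v + u v], so assume [P v < gamma v + u v]; the claim is
    that the point mass of the Monge-Ampere measure of [P] at [v], the sum of
    the [w e * P_e], vanishes, where [P_e] is the slope of [P] at [v] along the
    primitive vector [n_e] of the edge [e].

    As a supremum of functions in PC, [P] is in PC.  By balancing, [v] is a
    barycenter of points on its edges, and this gives that the mass is
    nonnegative ([PC_balanced_slopes_ge0]).  Suppose that it is positive.
    Smoothness makes the span of the [val v] vectors [n_e] have rank
    [val v - 1], so that balancing is, up to scaling, their only linear relation
    ([relation_unique]).  Choose [delta > 0] such that the slopes
    [P_e - delta * |n_e|] satisfy this relation: they are then the values at the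
    [n_e] of one linear form [l] on the whole space ([relation_functional]).  In
    other words, on [X] and near [v], the function [P] is the sum of an affine
    function and of [delta * |y - v|].

    It remains to exploit this conic dent ([envelope_contact]).  Raising [P]
    inside of a ball of radius [rho] to an affine function [L] that agrees with
    [P] on the sphere fills the dent, and the result is still in PC
    ([PC_add_cone]): at a point of the ball it equals [L], which is affine on
    the whole space, and at the points of a convex combination of that point it
    is at least [L].  For small [rho] the raised function is a competitor in the
    definition of the envelope, and it exceeds [P] at [v]: a contradiction.

    Two facts on polyhedra make this work for arbitrary polyhedral structures.
    Rational points are dense in rational polyhedra ([rational_points_dense]),
    which matters since convex combinations have rational points only.  And all
    faces of all polyhedral structures on a one-dimensional space have dimension
    at most one ([one_dimensional_dim_le1]), so that near a vertex [X] consists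
    of the edges at that vertex ([near_star]). *)

(** * Rational points of polyhedra *)

Section PairingTheory.
Context {F : comNzRingType} {n : nat}.
Implicit Types f x y : 'rV[F]_n.

Lemma pairing_mulmx f x : pairing f x = (x *m f^T) 0 0.
Proof. by rewrite !mxE; apply: eq_bigr => i _; rewrite !mxE mulrC. Qed.

Lemma pairingDr f x y : pairing f (x + y) = pairing f x + pairing f y.
Proof. by rewrite !pairing_mulmx mulmxDl mxE. Qed.

Lemma pairingZr f (a : F) x : pairing f (a *: x) = a * pairing f x.
Proof. by rewrite !pairing_mulmx -scalemxAl mxE. Qed.

Lemma pairing0l x : pairing 0 x = 0.
Proof. by rewrite pairing_mulmx trmx0 mulmx0 mxE. Qed.

Lemma pairing0r f : pairing f 0 = 0.
Proof. by rewrite pairing_mulmx mul0mx mxE. Qed.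

End PairingTheory.

Section RationalPoints.
Context {R : realType} {n : nat}.
Local Notation NR := 'rV[R]_n.

Lemma ofZ0 : (ofZ 0 : NR) = 0.
Proof. by apply/rowP => i; rewrite !mxE. Qed.

Lemma ofZ_eq0 (p : 'rV[int]_n) : (ofZ p : NR) = 0 -> p = 0.
Proof.
move=> /rowP p0; apply/rowP => i; move: (p0 i); rewrite !mxE => /eqP.
by rewrite intr_eq0 => /eqP.
Qed.

Lemma ofQD (x y : 'rV[rat]_n) : (ofQ (x + y) : NR) = ofQ x + ofQ y.
Proof. exact: map_mxD. Qed.

Lemma ofQZ (a : rat) (x : 'rV[rat]_n) : (ofQ (a *: x) : NR) = ratr a *: ofQ x.
Proof. exact: map_mxZ. Qed.

Lemma ofQM (k : nat) (x : 'rV[rat]_k) (A : 'M[rat]_(k, n)) :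
  (ofQ (x *m A) : NR) = ofQ x *m map_mx ratr A.
Proof. exact: map_mxM. Qed.

Lemma ofQ_ofZ (p : 'rV[int]_n) : (ofQ (ofZ p) : NR) = ofZ p.
Proof. by apply/rowP => i; rewrite !mxE ratr_int. Qed.

Lemma pairing_ofQ (f x : 'rV[rat]_n) :
  pairing (ofQ f) (ofQ x : NR) = ratr (pairing f x).
Proof.
by rewrite rmorph_sum; apply: eq_bigr => i _; rewrite !mxE rmorphM.
Qed.

Lemma row_linear_continuous (k : nat) (K : 'M[R]_(k, n)) :
  continuous (fun y : 'rV[R]_k => y *m K).
Proof.
have -> : (fun y : 'rV[R]_k => y *m K) = fun y => \sum_i y 0 i *: row i K.
  by apply/funext => y; rewrite mulmx_sum_row.
have coordK i : continuous (fun y : 'rV[R]_k => y 0 i *: row i K).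
  move=> y; apply: (@cvgZr_tmp R 'rV[R]_n _ (nbhs y) _ (fun z => z 0 i)).
  exact: coord_continuous.
by apply: (continuous_big add_continuous) => i _; exact: coordK.
Qed.

Lemma affZ_continuous (c : 'rV[int]_n * int) : continuous (affZ c : NR -> R).
Proof.
have coordM i : continuous (fun x : NR => (ofZ c.1 : NR) 0 i * x 0 i).
  move=> x; apply: (@cvgMl_tmp R _ (nbhs x) _ (fun z => z 0 i)).
  exact: coord_continuous.
have pairing_cont : continuous (pairing (ofZ c.1) : NR -> R).
  by apply: (continuous_big add_continuous) => i _; exact: coordM.
by move=> x; exact: (cvgD (pairing_cont x) (cvg_cst _)).
Qed.

Lemma affZ_segment (c : 'rV[int]_n * int) (x y : NR) (s : R) :
  affZ c ((1 - s) *: x + s *: y) = (1 - s) * affZ c x + s * affZ c y.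
Proof. by rewrite /affZ pairingDr !pairingZr; ring. Qed.

Lemma near_all_seq (T : eqType) (s : seq T) (Q : T -> set NR) (x : NR) :
  (forall c, c \in s -> \forall y \near x, Q c y) ->
  \forall y \near x, forall c, c \in s -> Q c y.
Proof.
elim: s => [|c s IHs] Qs; first by near=> y.
have Qc : \forall y \near x, Q c y by apply: Qs; rewrite inE eqxx.
have {}IHs : \forall y \near x, forall c, c \in s -> Q c y.
  by apply: IHs => d ds; apply: Qs; rewrite inE ds orbT.
near=> y => d; rewrite inE => /orP[/eqP ->|]; first by near: y.
by move: d; near: y.
Unshelve. all: by end_near. Qed.

Lemma rat_row_dense (y : NR) (U : set NR) :
  nbhs y U -> exists q : 'rV[rat]_n, U (ofQ q).
Proof.
move=> /nbhs_ballP[e /= e0 yeU].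
have /choice[q qy] : forall i, exists r : rat, `|y 0 i - ratr r| < e.
  move=> i; have /rat_in_itvoo[r] : y 0 i - e < y 0 i + e by lra.
  by rewrite in_itv /= => ry; exists r; rewrite ltr_distlC.
exists (\row_i q i); apply: yeU; split=> // i j.
by rewrite ord1 !mxE /ball /=; exact: qy.
Qed.

(** The constraints active at [x] form a linear system with rational
    coefficients that has a real solution: it has a rational solution, and its
    rational solutions are dense among the real ones since the kernel has a
    rational basis.  The inactive constraints remain strict close to [x]. *)
Lemma rational_points_dense (sigma : set NR) (x : NR) (U : set NR) :
  rational_polyhedron sigma -> sigma x -> nbhs x U ->
  exists2 q : 'rV[rat]_n, sigma (ofQ q) & U (ofQ q).
Proof.
move=> [E [I ->]] /= [xE xI] xU.
pose s := E ++ [seq c <- I | affZ c x == 0].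
pose c0 : 'rV[int]_n * int := (0, 0).
have s0 c : c \in s -> affZ c x = 0.
  by rewrite mem_cat mem_filter => /orP[/xE //|/andP[/eqP]].
pose A : 'M[rat]_(n, size s) :=
  \matrix_(i, j) ((nth c0 s j).1 0 i)%:~R.
pose b : 'rV[rat]_(size s) := \row_j (- (nth c0 s j).2)%:~R.
have systemE (y : NR) : y *m map_mx ratr A = map_mx ratr b ->
    forall c, c \in s -> affZ c y = 0.
  move=> /rowP yA c /(nthP c0)[j js <-]; move: (yA (Ordinal js)).
  rewrite /affZ !mxE ratr_int /= => yAj; apply/eqP.
  rewrite addr_eq0 -mulrNz -yAj; apply/eqP/eq_bigr => i _.
  by rewrite !mxE ratr_int mulrC.
have xA : x *m map_mx ratr A = map_mx ratr b.
  apply/rowP => j; have /eqP := s0 _ (mem_nth c0 (ltn_ord j)).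
  rewrite /affZ addr_eq0 !mxE ratr_int mulrNz => /eqP <-.
  by apply: eq_bigr => i _; rewrite !mxE ratr_int mulrC.
have : (map_mx (ratr : rat -> R) b <= map_mx ratr A)%MS.
  by rewrite -xA submxMl.
rewrite map_submx => /submxP[q0 bq0].
have : (x - ofQ q0 <= kermx (map_mx ratr A))%MS.
  by apply/sub_kermxP; rewrite mulmxBl xA bq0 map_mxM subrr.
rewrite -map_kermx => /submxP[y yx].
pose K : 'M[R]_n := map_mx ratr (kermx A).
have xE' : x = y *m K + ofQ q0 by rewrite -yx subrK.
have xI' : \forall z \near x, forall c, c \in I -> affZ c x != 0 ->
    0 < affZ c z.
  apply: (@near_all_seq _ _ (fun c z => affZ c x != 0 -> 0 < affZ c z)).
  move=> c cI; have [cx|cx] := eqVneq (affZ c x) 0.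
    by near=> z => /negP[]; exact/eqP.
  have c0x : 0 < affZ c x by rewrite lt_def cx xI.
  by near=> z => _; near: z; exact: (cvgr_gt _ (@affZ_continuous c x)).
pose V z := U z /\ forall c, c \in I -> affZ c x != 0 -> 0 < affZ c z.
have xV : nbhs x V by exact: filterI.
have : nbhs y (fun z => V (z *m K + ofQ q0)).
  have : (fun z => z *m K + ofQ q0) z @[z --> y] --> (y *m K + ofQ q0).
    apply: (@cvgD R NR _ (nbhs y) _ (fun z => z *m K) (fun=> ofQ q0)).
      exact: row_linear_continuous.
    exact: cvg_cst.
  by apply; rewrite -xE'.
move=> /rat_row_dense[d Vd].
have qE : ofQ d *m K + ofQ q0 = ofQ (d *m kermx A + q0) :> NR.
  by rewrite ofQD ofQM.
rewrite qE in Vd.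
have q_active : forall c, c \in s -> affZ c (ofQ (d *m kermx A + q0) : NR) = 0.
  apply: systemE.
  by rewrite -map_mxM mulmxDl -mulmxA mulmx_ker mulmx0 add0r -bq0.
exists (d *m kermx A + q0); last by case: Vd.
split=> [c cE|c cI]; first by apply: q_active; rewrite mem_cat cE.
have [cx|cx] := eqVneq (affZ c x) 0; last by case: Vd => _ /(_ _ cI cx)/ltW.
by rewrite q_active// mem_cat mem_filter cx eqxx cI orbT.
Unshelve. all: by end_near. Qed.

End RationalPoints.

(** * Dimension of the faces *)

Section ConvexSets.
Context {R : realType} {n : nat}.
Local Notation NR := 'rV[R]_n.
Local Notation dim := Defs.dim.
Implicit Types (sigma C : set NR) (F Pi : set (set NR)).

Definition segment_closed C : Prop :=
  forall x y (s : R), C x -> C y -> 0 <= s <= 1 -> C ((1 - s) *: x + s *: y).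

Lemma rational_polyhedron_segment_closed sigma :
  rational_polyhedron sigma -> segment_closed sigma.
Proof.
move=> [E [I ->]] x y s [xE xI] [yE yI] /andP[s0 s1]; split=> c cEI.
  by rewrite affZ_segment xE// yE// !mulr0 addr0.
by rewrite affZ_segment addr_ge0 ?mulr_ge0 ?subr_ge0 ?xI ?yI.
Qed.

Lemma dirspace_mem sigma x y : sigma x -> sigma y -> x - y \in dirspace sigma.
Proof. by move=> sx sy; apply: (linspanP _).1; exists x, y. Qed.

Lemma dirspace_sub sigma (W : {vspace NR}) :
  (forall x y, sigma x -> sigma y -> x - y \in W) -> (dirspace sigma <= W)%VS.
Proof.
by move=> sW; apply: (linspanP _).2 => _ [x [y [sx sy ->]]]; exact: sW.
Qed.

Lemma dim_le sigma (W : {vspace NR}) :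
  (forall x y, sigma x -> sigma y -> x - y \in W) -> (dim sigma <= \dim W)%N.
Proof. by move=> sW; exact/dimvS/dirspace_sub. Qed.

Lemma dim0_singleton sigma v : dim sigma = 0%N -> sigma v -> sigma = [set v].
Proof.
move=> /eqP; rewrite dimv_eq0 => /eqP s0 sv.
apply/seteqP; split=> [x sx|x -> //].
by have := dirspace_mem sx sv; rewrite s0 memv0 subr_eq0 => /eqP.
Qed.

Lemma pigeonhole (T : Type) (A : set T) (g : nat -> T) :
  finite_set A -> (forall k, A (g k)) -> exists i j, i <> j /\ g i = g j.
Proof.
move=> finA Ag; apply: contrapT => noij; apply: infinite_nat.
have -> : [set: nat] = g @^-1` A by apply/seteqP; split=> k _ //; exact: Ag.
apply: (@finite_preimage _ _ A g) => // i j _ _ gij.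
by apply: contrapT => ij; apply: noij; exists i, j.
Qed.

Lemma harmonic_inj : injective (@harmonic R).
Proof. by move=> i j /invr_inj/eqP; rewrite eqr_nat eqSS => /eqP. Qed.

Lemma harmonic_itv01 k : 0 <= (@harmonic R k) <= 1.
Proof. by rewrite /harmonic invr_ge0 ler0n invf_le1 ?ltr0n// ler1n. Qed.

Lemma line_in_plane (D : {vspace NR}) (u w : NR) :
  (\dim D <= 1)%N -> u != 0 -> u \in D -> w \in D -> w \in <[u]>%VS.
Proof.
move=> D1 u0 uD; have /eqP -> // : (<[u]> == D)%VS.
by rewrite eqEdim dim_vline u0 -memvE uD.
Qed.

(** If [a], [b], [c] are points of [C], then by the pigeonhole principle each
    of the infinitely many segments from [a] to a point of the segment [b, c]
    has two points in common with a set of the cover, and two of these segments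
    do so with the same set of the cover.  A line then contains both of their
    directions, hence [b - a] and [c - a]. *)
Lemma segment_closed_cover_dim_le1 C F :
  finite_set F -> (forall sigma, F sigma -> (dim sigma <= 1)%N) ->
  segment_closed C -> C `<=` union_of_faces F -> (dim C <= 1)%N.
Proof.
move=> finF F1 Cseg CF.
have [[a [b [Ca Cb ba]]]|noab] :=
    pselect (exists a b, [/\ C a, C b & b - a != 0]); last first.
  apply: (@leq_trans (\dim (0 : {vspace NR}))); last by rewrite dimv0.
  apply: dim_le => x y Cx Cy; rewrite memv0.
  by apply: contraPT isT => xy _; apply: noab; exists y, x.
suff ca : forall c, C c -> c - a \in <[b - a]>%VS.
  apply: (@leq_trans (\dim <[b - a]>)); last by rewrite dim_vline ba.
  apply: dim_le => x y Cx Cy.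
  have -> : x - y = (x - a) - (y - a) by rewrite opprB addrA subrK.
  by rewrite rpredB ?ca.
move=> c Cc.
pose p k : NR := (1 - harmonic k) *: b + harmonic k *: c.
pose d k : NR := p k - a.
have Cp k : C (p k) by apply: Cseg => //; exact: harmonic_itv01.
have /choice[D DP] : forall k, exists sigma, F sigma /\ d k \in dirspace sigma.
  move=> k; pose q m : NR := (1 - harmonic m) *: a + harmonic m *: p k.
  have /choice[g gP] : forall m, exists sigma, F sigma /\ sigma (q m).
    move=> m; have [|sigma Fs sq] := CF (q m); last by exists sigma.
    by apply: Cseg => //; exact: harmonic_itv01.
  have [i [j [ij gij]]] := pigeonhole finF (fun m => (gP m).1).
  exists (g i); split; first by case: (gP i).
  have gi := (gP i).2; have gj := (gP j).2; rewrite -gij in gj.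
  have := dirspace_mem gi gj.
  have -> : q i - q j = (harmonic i - harmonic j) *: d k.
    by apply/rowP => l; rewrite !mxE; ring.
  rewrite rpredZeq => /orP[|//]; rewrite subr_eq0 => /eqP/harmonic_inj ji.
  by case: ij.
have [i [j [ij Dij]]] := pigeonhole finF (fun m => (DP m).1).
have [Fi di] := DP i; have [_ dj] := DP j; rewrite -Dij in dj.
have cb : c - b \in dirspace (D i).
  have : d i - d j \in dirspace (D i) by rewrite rpredB.
  have -> : d i - d j = (harmonic i - harmonic j) *: (c - b).
    by apply/rowP => l; rewrite !mxE; ring.
  rewrite rpredZeq => /orP[|//]; rewrite subr_eq0 => /eqP/harmonic_inj ji.
  by case: ij.
have baD : b - a \in dirspace (D i).
  have -> : b - a = d i - harmonic i *: (c - b).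
    by apply/rowP => l; rewrite !mxE; ring.
  by rewrite rpredB ?rpredZ.
apply: (line_in_plane (F1 _ Fi)) => //.
have -> : c - a = (c - b) + (b - a) by rewrite addrA subrK.
by rewrite rpredD.
Qed.

Lemma exists_maximal_superset (s : seq (set NR)) sigma :
  exists sigma', [/\ sigma' = sigma \/ sigma' \in s, sigma `<=` sigma' &
    forall tau, tau \in s -> sigma' `<=` tau -> tau `<=` sigma'].
Proof.
elim: s => [|tau s [sigma' [ss' sub mx]]].
  by exists sigma; split=> //; left.
have [st|st] := pselect (sigma' `<=` tau); last first.
  exists sigma'; split=> //.
    by case: ss' => [->|s's]; [left|right; rewrite inE s's orbT].
  by move=> tau'; rewrite inE => /orP[/eqP -> //|/mx].
exists tau; split; first by right; rewrite inE eqxx.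
  exact: subset_trans st.
move=> tau'; rewrite inE => /orP[/eqP -> //|t's tt'].
by apply: (subset_trans (mx _ t's _)) => //; exact: (subset_trans st tt').
Qed.

Lemma one_dimensional_dim_le1 (X : set NR) Pi sigma :
  one_dimensional X -> polyhedral_structure X Pi -> Pi sigma ->
  (dim sigma <= 1)%N.
Proof.
move=> [Pi1 [Pi1c Pi1X] maxdim] [Pic PiX] Pis.
have [s Pi1s] := (finite_seqP _).1 (pc_finite Pi1c).
apply: (segment_closed_cover_dim_le1 (F := Pi1)); first exact: pc_finite.
- move=> tau Pi1tau; have [tau' [tt' sub mx]] := exists_maximal_superset s tau.
  have Pi1tau' : Pi1 tau' by case: tt' => [-> //|t's]; rewrite Pi1s.
  rewrite -(maxdim _ Pi1tau').
    apply: dim_le => x y tx ty.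
    by apply: dirspace_mem; apply: sub.
  move=> rho Pi1rho tr; apply/seteqP; split=> //; apply: mx => //.
  by move: Pi1rho; rewrite Pi1s.
- apply: rational_polyhedron_segment_closed.
  exact: (pc_polyhedron Pic).
- by rewrite Pi1X -PiX => x sx; exists sigma.
Qed.

Lemma rational_polyhedron_closed sigma x :
  rational_polyhedron sigma -> ~ sigma x -> \forall y \near x, ~ sigma y.
Proof.
move=> [E [I ->]] /= nx.
have [/allP xE|/allPn[c cE cx]] := boolP (all (fun c => affZ c x == 0) E).
  have [/allP xI|/allPn[c cI cx]] := boolP (all (fun c => 0 <= affZ c x) I).
    by case: nx; split=> c cEI; [apply/eqP; exact: xE|exact: xI].
  have cx0 : affZ c x < 0 by rewrite ltNge.
  have : \forall y \near x, affZ c y < 0.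
    exact: (cvgr_lt _ (@affZ_continuous R n c x)).
  by apply: filterS => y cy [_ /(_ _ cI)]; rewrite leNgt cy.
have : \forall y \near x, affZ c y != 0.
  exact: (cvgr_neq0 _ (@affZ_continuous R n c x)).
by apply: filterS => y cy [/(_ _ cE) /eqP]; rewrite (negbTE cy).
Qed.

End ConvexSets.

(** * Vectors with a single linear relation *)

Section Relations.
Context {R : realType} {n r : nat}.
Implicit Types (A : 'M[R]_(r, n)) (w c : 'rV[R]_r).

(** The linear map sending the coefficients [c] to [c *m A] has an image of
    dimension at least [r - 1], hence a kernel of dimension at most [1]. *)
Lemma relation_unique A w (S : set 'rV[R]_n) :
  (forall x, S x -> exists c, x = c *m A) ->
  (r <= (\dim (linspan S)).+1)%N ->
  w != 0 -> w *m A = 0 ->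
  forall c, c *m A = 0 -> exists k, c = k *: w.
Proof.
move=> SA rS w0 wA c cA.
pose f : 'Hom('rV[R]_r, 'rV[R]_n) := linfun (mulmxr A).
have kerf c' : c' *m A = 0 -> c' \in lker f.
  by rewrite memv_ker lfunE /= => ->.
have Sf : (\dim (linspan S) <= \dim (limg f))%N.
  apply: dimvS; apply: (linspanP S).2 => x /SA[c' ->].
  by have := memv_img f (memvf c'); rewrite lfunE.
have := limg_ker_dim f fullv; rewrite capfv dimvf /dim /= mul1n => dimE.
have kerle1 : (\dim (lker f) <= 1)%N.
  by rewrite -(leq_add2r (\dim (limg f))) dimE (leq_trans rS)// add1n ltnS.
by apply/vlineP/(line_in_plane kerle1) => //; exact: kerf.
Qed.

(** Appending the column [b] to [A] keeps the relation [w], so the rank, which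
    is already at least [r - 1], does not grow: [b] is in the column space of
    [A]. *)
Lemma relation_functional A w (b : 'cV[R]_r) :
  (forall c, c *m A = 0 -> exists k, c = k *: w) ->
  w != 0 -> w *m A = 0 -> w *m b = 0 ->
  exists l : 'cV[R]_n, A *m l = b.
Proof.
move=> wker w0 wA wb.
have rankA : (r - \rank A <= 1)%N.
  rewrite -mxrank_ker; apply: (@leq_trans (\rank w)); last exact: rank_leq_row.
  apply/mxrankS/row_subP => i; apply/sub_rVP/wker.
  by apply/sub_kermxP; exact: row_sub.
have rankAb : (0 < r - \rank (row_mx A b))%N.
  rewrite -mxrank_ker; apply: (@leq_trans (\rank w)).
    by rewrite rank_rV w0.
  apply/mxrankS/sub_kermxP.
  by rewrite mul_mx_row wA wb row_mx0.
have sub : (A^T <= (row_mx A b)^T)%MS.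
  by rewrite tr_row_mx -addsmxE addsmxSl.
have le : (b^T <= A^T)%MS.
  apply: (@submx_trans _ _ _ _ _ _ (row_mx A b)^T).
    by rewrite tr_row_mx -addsmxE addsmxSr.
  rewrite -(mxrank_leqif_sup sub) !mxrank_tr eqn_leq.
  by have := mxrankS sub; rewrite !mxrank_tr; lia.
have [l bl] := submxP le.
by exists l^T; apply: trmx_inj; rewrite trmx_mul trmxK.
Qed.

(** The basis vector at [i] is a relation, hence a multiple of [w], all of whose
    entries are nonzero. *)
Lemma zero_row_sole_index A w i :
  (forall c, c *m A = 0 -> exists k, c = k *: w) ->
  (forall j, w 0 j != 0) -> row i A = 0 -> forall j, j = i.
Proof.
move=> wker w_neq0 Ai0 j.
have [k deltaE] : exists k, delta_mx 0 i = k *: w.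
  by apply: wker; rewrite -rowE.
have kw m : (i == m)%:R = k * w 0 m.
  by have /rowP/(_ m) := deltaE; rewrite !mxE eqxx eq_sym.
have k0 : k != 0.
  apply/eqP => k0; have := kw i; rewrite k0 mul0r eqxx => /eqP.
  by rewrite oner_eq0.
apply/eqP; rewrite eq_sym; apply: contraT => /negbTE ij.
have /esym/eqP := kw j.
by rewrite ij mulf_eq0 (negbTE k0) (negbTE (w_neq0 j)).
Qed.

End Relations.

(** * Polyhedrally convex functions *)

Section ConvexFunctions.
Context {R : realType} {n : nat}.
Local Notation NR := 'rV[R]_n.
Implicit Types (X sigma tau : set NR) (P : NR -> R) (v x y z : NR).

Lemma face_refl sigma : sigma !=set0 -> face sigma sigma.
Proof.
move=> s0; split=> //; exists 0; apply/seteqP; split=> [x sx|x []//].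
by split=> // y _; rewrite !pairing0l.
Qed.

Lemma face_sub tau sigma : face tau sigma -> tau `<=` sigma.
Proof. by move=> [_ [f ->]] x []. Qed.

Lemma PC_segment X P Pi sigma (x z : 'rV[rat]_n) (s : R) :
  PC X P -> polyhedral_structure X Pi -> Pi sigma ->
  sigma (ofQ x) -> sigma (ofQ z) -> 0 <= s <= 1 ->
  P ((1 - s) *: ofQ x + s *: ofQ z) <= (1 - s) * P (ofQ x) + s * P (ofQ z).
Proof.
move=> [_ PCP] [Pic PiX] Pis sx sz /andP[s0 s1].
have sX y : sigma y -> X y by rewrite -PiX => sy; exists sigma.
pose y : NR := (1 - s) *: ofQ x + s *: ofQ z.
have sy : sigma y.
  apply: (rational_polyhedron_segment_closed (pc_polyhedron Pic Pis)) => //.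
  by rewrite s0.
pose xs (i : 'I_2) : NR := ofQ (if i == ord0 then x else z).
pose alpha (i : 'I_2) : R := if i == ord0 then 1 - s else s.
have sxs i : sigma (xs i) by rewrite /xs; case: ifP.
have := PCP 2%N y xs alpha; rewrite !big_ord_recl !big_ord0 !addr0 /=.
apply; split; first exact: sX.
- by move=> i; split; [apply: sX|exists (if i == ord0 then x else z)].
- split; last by rewrite !big_ord_recl !big_ord0 /alpha /=; ring.
  by move=> i; rewrite /alpha; case: ifP => _; lra.
- by rewrite !big_ord_recl big_ord0 addr0.
- exists Pi, sigma, (fun=> sigma); split=> // i; split=> //.
  by apply: face_refl; exists (ofQ x).
Qed.

Lemma dist_continuous v : continuous (fun y : NR => `|y - v|).
Proof.
move=> y; apply: (@cvg_norm _ _ _ (nbhs y) _ (fun z : NR => z - v)).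
by apply: cvgB; [exact: cvg_id|exact: cvg_cst].
Qed.

Lemma sphere_crossing v x z (rho : R) :
  `|x - v| < rho -> rho < `|z - v| ->
  exists2 s, 0 <= s <= 1 & `|(1 - s) *: x + s *: z - v| = rho.
Proof.
move=> xv vz; pose f (s : R) := `|(1 - s) *: x + s *: z - v|.
have f_cont : continuous f.
  move=> s; apply: cvg_norm; apply: cvgB; last exact: cvg_cst.
  apply: cvgD; apply: cvgZr_tmp; last exact: cvg_id.
  by apply: cvgB; [exact: cvg_cst|exact: cvg_id].
have f0 : f 0 = `|x - v| by rewrite /f subr0 scale1r scale0r addr0.
have f1 : f 1 = `|z - v| by rewrite /f subrr scale1r scale0r add0r.
have [||s] := @IVT R f 0 1 rho ler01.
- exact: continuous_subspaceT.
- by rewrite f0 f1 ge_min le_max (ltW xv) (ltW vz) orbT.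
- by rewrite in_itv /= => s01 fs; exists s.
Qed.

Definition cone v (rho delta : R) (y : NR) : R :=
  Num.max 0 (delta * (rho - `|y - v|)).

Lemma cone_continuous v (rho delta : R) : continuous (cone v rho delta).
Proof.
have slope_cont : continuous (fun y : NR => delta * (rho - `|y - v|)).
  move=> y; apply: (@cvgMl_tmp R _ (nbhs y) _ (fun z : NR => rho - `|z - v|)).
  apply: cvgB; first exact: cvg_cst.
  exact: dist_continuous.
move=> y; apply: (@continuous_max R NR (fun=> 0) _ y).
  exact: cst_continuous.
exact: slope_cont.
Qed.

(** Let [L] be the affine function [c + l + delta * rho].  The cone raises [P]
    to [L] on the ball, so for a combination of a point [x] of the ball it
    suffices that the new function is at least [L] at each endpoint [z].  The
    difference [P - L] is negative inside of the ball and zero on the sphere.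
    If it were negative at an endpoint outside of the ball, then, by convexity
    on a face that contains [x] and [z], it would be negative where the segment
    from [x] to [z] crosses the sphere. *)
Lemma PC_add_cone X P v (rho delta c : R) (l : NR) :
  PC X P -> 0 < rho -> 0 < delta ->
  (forall y, X y -> `|y - v| <= rho ->
     P y = c + pairing l y + delta * `|y - v|) ->
  PC X (fun y => P y + cone v rho delta y).
Proof.
move=> PCP rho0 delta0 Pball.
have cone_ge0 y : 0 <= cone v rho delta y by rewrite le_max lexx.
pose L y := c + pairing l y + delta * rho.
have endpoint Pi sigma x (z : 'rV[rat]_n) :
    polyhedral_structure X Pi -> Pi sigma -> sigma x -> sigma (ofQ z) ->
    `|x - v| < rho ->
    L (ofQ z) <= P (ofQ z) + cone v rho delta (ofQ z).
  move=> PiX Pis sx sz xv; have [Pic UPi] := PiX.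
  have sX y : sigma y -> X y by rewrite -UPi => sy; exists sigma.
  have [zv|vz] := leP `|ofQ z - v| rho.
    rewrite (Pball _ (sX _ sz) zv) /L /cone -!addrA !lerD2l.
    rewrite -lerBlDl le_max; apply/orP; right.
    by rewrite mulrBr.
  apply: (@le_trans _ _ (P (ofQ z))); last by rewrite lerDl.
  (* Convexity on a face holds for combinations of rational points: x is moved
     to a rational point of sigma that is still in the ball. *)
  have [q sq /= qv] : exists2 q, sigma (ofQ q) & `|ofQ q - v| < rho.
    apply: (rational_points_dense (U := fun y => `|y - v| < rho) _ sx).
      exact: (pc_polyhedron Pic).
    exact: (cvgr_lt _ (@dist_continuous v x)).
  have [s s01 srho] := sphere_crossing qv vz.
  have := PC_segment PCP PiX Pis sq sz s01.
  have sy : sigma ((1 - s) *: ofQ q + s *: ofQ z).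
    apply: (rational_polyhedron_segment_closed _ sq sz s01).
    exact: (pc_polyhedron Pic).
  have dq : 0 < delta * rho - delta * `|ofQ q - v| by rewrite subr_gt0 ltr_pM2l.
  rewrite (Pball _ (sX _ sy)) srho// (Pball _ (sX _ sq) (ltW qv)).
  rewrite pairingDr !pairingZr => Pconv; rewrite leNgt; apply/negP => PzL.
  have {}PzL : 0 < L (ofQ z) - P (ofQ z) by rewrite subr_gt0.
  have : 0 < (1 - s) * (delta * rho - delta * `|ofQ q - v|) +
             s * (L (ofQ z) - P (ofQ z)).
    have /andP[s0] := s01; rewrite le_eqVlt => /orP[/eqP ->|s1].
      by rewrite subrr mul0r add0r mul1r.
    apply: ltr_pwDl; first by apply: mulr_gt0; rewrite // subr_gt0.
    exact/mulr_ge0/ltW.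
  by rewrite ltNge => /negP; apply; move: Pconv; rewrite /L; lra.
split.
  have cone_within : {within X, continuous (cone v rho delta)}.
    by apply: continuous_subspaceT; exact: cone_continuous.
  by move=> x; apply: cvgD; [exact: PCP.1|exact: cone_within].
move=> k x xs alpha comb.
have [Xx Xxs [alpha01 alpha1] xE [Pi [tau [sigma [PiX Pitau taux Pisig]]]]] :=
  comb.
have alpha_ge0 i : 0 <= alpha i by have /andP[] := alpha01 i.
have [vx|xv] := leP rho `|x - v|.
  have -> : cone v rho delta x = 0.
    by apply/max_idPl; rewrite pmulr_rle0// subr_le0.
  rewrite addr0; apply: (le_trans (PCP.2 _ _ _ _ comb)).
  by apply: ler_sum => i _; rewrite ler_wpM2l// lerDl.
have -> : P x + cone v rho delta x = L x.
  rewrite (Pball _ Xx (ltW xv)) /cone /L.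
  have /max_idPr -> : 0 <= delta * (rho - `|x - v|).
    by rewrite mulr_ge0 ?subr_ge0 ?ltW.
  by ring.
have -> : L x = \sum_(i < k) alpha i * L (xs i).
  rewrite /L.
  have -> : pairing l x = \sum_(i < k) alpha i * pairing l (xs i).
    rewrite xE pairing_mulmx mulmx_suml summxE; apply: eq_bigr => i _.
    by rewrite -pairing_mulmx pairingZr.
  under [RHS]eq_bigr do rewrite !mulrDr.
  by rewrite !big_split /= -!mulr_suml alpha1 !mul1r.
apply: ler_sum => i _; apply: ler_wpM2l => //.
have [_ [q qE]] := Xxs i; have [Pis sxs /face_sub tausig] := Pisig i.
by rewrite qE; apply: endpoint Pis (tausig _ taux) _ xv => //; rewrite -qE.
Qed.

End ConvexFunctions.

Section MassNonneg.
Context {R : realType} {n : nat}.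
Local Notation NR := 'rV[R]_n.

(** The vertex [v] is the barycenter of the points [v + t i *: N i] with
    weights proportional to [w i / t i]. *)
Lemma PC_balanced_slopes_ge0 (X : set NR) (P : NR -> R) Pi (r : nat)
    (v : 'rV[rat]_n) (e : 'I_r -> set NR) (N : 'I_r -> 'rV[int]_n)
    (w p : 'I_r -> R) (t : 'I_r -> rat) :
  PC X P -> polyhedral_structure X Pi -> Pi [set ofQ v] ->
  (forall i, Pi (e i) /\ face [set ofQ v] (e i)) ->
  (forall i, 0 < w i) -> (forall i, 0 < t i) ->
  (forall i, e i (ofQ v + ratr (t i) *: ofZ (N i))) ->
  (forall i, P (ofQ v + ratr (t i) *: ofZ (N i)) =
             P (ofQ v) + ratr (t i) * p i) ->
  \sum_i w i *: (ofZ (N i) : NR) = 0 ->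
  0 <= \sum_i w i * p i.
Proof.
move=> PCP PiX Piv Pie w0 t0 et Pt balance.
have T0 i : 0 < ratr (t i) :> R by rewrite ltr0q.
have wt0 i : 0 < w i / ratr (t i) by rewrite divr_gt0.
have UPi := PiX.2.
pose S := \sum_i w i / ratr (t i).
have [S0|S0] := eqVneq S 0.
  rewrite big1// => i _.
  have wti : w i / ratr (t i) = 0.
    by apply: (psumr_eq0P _ S0) => // j _; exact: ltW.
  by have := wt0 i; rewrite wti ltxx.
have {}S0 : 0 < S by rewrite lt_def S0 sumr_ge0// => i _; exact: ltW.
pose alpha i := w i / ratr (t i) / S.
have alpha_ge0 i : 0 <= alpha i by rewrite divr_ge0// ltW.
have alpha1 : \sum_i alpha i = 1 by rewrite -mulr_suml divff// gt_eqF.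
have alphat i : alpha i * ratr (t i) = S^-1 * w i.
  by rewrite /alpha; field; rewrite (lt0r_neq0 S0) (lt0r_neq0 (T0 i)).
pose xs i : NR := ofQ v + ratr (t i) *: ofZ (N i).
have vE : ofQ v = \sum_i alpha i *: xs i.
  have xsE i : alpha i *: xs i = alpha i *: ofQ v + S^-1 *: (w i *: ofZ (N i)).
    by rewrite scalerDr !scalerA alphat.
  under eq_bigr do rewrite xsE.
  by rewrite big_split /= -scaler_suml alpha1 -scaler_sumr balance
    scaler0 scale1r addr0.
have /(PCP.2 _ _ _ _) : convex_combination X (ofQ v) xs alpha.
  split=> //.
  - by rewrite -UPi; exists [set ofQ v].
  - move=> i; split; first by rewrite -UPi; exists (e i); [case: (Pie i)|].
    by exists (v + t i *: ofZ (N i)); rewrite ofQD ofQZ ofQ_ofZ.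
  - split=> // i; rewrite alpha_ge0 -alpha1 (bigD1 i)//= lerDl.
    by apply: sumr_ge0.
  - exists Pi, [set ofQ v], e; split=> // i.
    by have [Piei vei] := Pie i.
have -> : \sum_i alpha i * P (xs i) = P (ofQ v) + S^-1 * \sum_i w i * p i.
  have PxsE i : alpha i * P (xs i) = alpha i * P (ofQ v) + S^-1 * (w i * p i).
    rewrite Pt mulrDr [alpha i * (_ * p i)]mulrA alphat; congr (_ + _).
    by rewrite mulrA.
  under eq_bigr do rewrite PxsE.
  by rewrite big_split /= -mulr_suml alpha1 mul1r -mulr_sumr.
by rewrite lerDl pmulr_rge0// invr_gt0.
Qed.

End MassNonneg.

(** * The envelope *)

Section Envelope.
Context {R : realType} {n : nat}.
Local Notation NR := 'rV[R]_n.

Lemma within_near_gt (X : set NR) (f : NR -> R) v (a : R) :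
  {within X, continuous f} -> X v -> a < f v ->
  \forall y \near v, X y -> a < f y.
Proof.
move=> /subspace_continuousP /(_ v) fv Xv av.
exact: (cvgr_gt _ (fv Xv)).
Qed.

Variables (X : set NR) (gamma u : NR -> R).
Hypotheses (PCgamma : PC X gamma) (ubounded : bounded_on X u).

Lemma PC_add_cst (P : NR -> R) (c : R) : PC X P -> PC X (fun x => P x + c).
Proof.
move=> [Pcont PCP]; split.
  by move=> x; apply: cvgD; [exact: Pcont|exact: cvg_cst].
move=> k x xs alpha comb; have [_ _ [_ alpha1] _ _] := comb.
under eq_bigr do rewrite mulrDr.
by rewrite big_split /= -mulr_suml alpha1 mul1r lerD2r; exact: PCP.
Qed.

Lemma envelope_ge (psi : NR -> R) x :
  PC X psi -> (forall z, X z -> psi z <= gamma z + u z) ->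
  (exists C : R, forall z, X z -> psi z <= gamma z + C) ->
  X x -> psi x <= envelope X gamma u x.
Proof.
move=> PCpsi psile psiC Xx; apply: ub_le_sup; last by exists psi.
by exists (gamma x + u x) => _ [psi' [_ psi'le _ ->]]; exact: psi'le.
Qed.

Lemma envelope_lub x (c : R) : X x ->
  (forall psi : NR -> R, PC X psi ->
    (forall z, X z -> psi z <= gamma z + u z) ->
    (exists C : R, forall z, X z -> psi z <= gamma z + C) -> psi x <= c) ->
  envelope X gamma u x <= c.
Proof.
move=> Xx psi_le; apply: ge_sup; last first.
  by move=> _ [psi [PCpsi psile psiC ->]]; exact: psi_le.
have [C uC] := ubounded.
exists (gamma x - C), (fun z => gamma z - C); split=> //.
- exact: PC_add_cst.
- move=> z Xz; rewrite lerD2l lerNl (le_trans _ (uC _ Xz))//.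
  by rewrite lerNl lerNnormlW.
- by exists (- C).
Qed.

Lemma envelope_le x : X x -> envelope X gamma u x <= gamma x + u x.
Proof. by move=> Xx; apply: envelope_lub => // psi _ psile _; exact: psile. Qed.

Lemma PC_envelope : {within X, continuous (envelope X gamma u)} ->
  PC X (envelope X gamma u).
Proof.
move=> Pcont; split=> // k x xs alpha comb.
have [Xx Xxs [alpha01 _] _ _] := comb.
apply: envelope_lub => // psi PCpsi psile psiC.
apply: (le_trans (PCpsi.2 _ _ _ _ comb)); apply: ler_sum => i _.
have /andP[alpha0 _] := alpha01 i; have [Xi _] := Xxs i.
by apply: ler_wpM2l => //; exact: envelope_ge.
Qed.

(** Adding to the envelope a small cone at [v] gives a larger competitor, unless
    the obstacle [gamma + u] is touched at [v]. *)
Lemma envelope_contact v (c delta : R) (l : NR) :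
  {within X, continuous u} -> {within X, continuous (envelope X gamma u)} ->
  X v -> 0 < delta ->
  (\forall y \near v, X y ->
     envelope X gamma u y = c + pairing l y + delta * `|y - v|) ->
  gamma v + u v <= envelope X gamma u v.
Proof.
set P := envelope X gamma u; move=> uc Pcont Xv delta0 Pnear.
rewrite leNgt; apply/negP => vlt.
pose eta := gamma v + u v - P v.
have eta0 : 0 < eta by rewrite subr_gt0.
have gap_cont : {within X, continuous (fun y => gamma y + u y - P y)}.
  move=> y; apply: cvgB; last exact: Pcont.
  by apply: cvgD; [exact: PCgamma.1|exact: uc].
have gap : \forall y \near v, X y -> eta / 2 < gamma y + u y - P y.
  by apply: (within_near_gt gap_cont) => //; rewrite -/eta; lra.
have [r0 /= r0_gt0 ball_r0] := (nbhs_normP _ _).1 (filterI Pnear gap).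
(* The first bound keeps the closed ball of radius rho in the open ball of
   radius r0; the second one keeps the height delta * rho of the cone below
   eta / 2. *)
pose rho := Num.min (r0 / 2) (eta / (2 * delta)).
have rho0 : 0 < rho by rewrite lt_min !divr_gt0// mulr_gt0.
have rho_near y : `|y - v| <= rho -> X y ->
    P y = c + pairing l y + delta * `|y - v| /\
    eta / 2 < gamma y + u y - P y.
  move=> yv Xy; have [] := ball_r0 y.
    rewrite /ball_ /= distrC; apply: (le_lt_trans yv).
    by apply: (@le_lt_trans _ _ (r0 / 2)); [rewrite ge_min lexx|lra].
  by move=> /(_ Xy) ? /(_ Xy).
have PCbump : PC X (fun y => P y + cone v rho delta y).
  apply: (PC_add_cone (PC_envelope Pcont) rho0 delta0) => y Xy yv.
  exact: (rho_near y yv Xy).1.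
have cone_le y : cone v rho delta y <= eta / 2.
  rewrite ge_max divr_ge0 ?(ltW eta0)//= (@le_trans _ _ (delta * rho))//.
    by rewrite ler_pM2l// gerBl.
  rewrite -ler_pdivlMl// ge_min; apply/orP; right.
  by rewrite le_eqVlt; apply/orP; left; apply/eqP; field; exact: lt0r_neq0.
have bump_le y : X y -> P y + cone v rho delta y <= gamma y + u y.
  move=> Xy; have [yv|vy] := leP `|y - v| rho.
    by have [_] := rho_near y yv Xy; have := cone_le y; lra.
  rewrite (_ : cone _ _ _ _ = 0) ?addr0; first exact: envelope_le.
  by apply/max_idPl; rewrite pmulr_rle0// subr_le0 ltW.
have [C uC] := ubounded.
have := envelope_ge PCbump bump_le _ Xv.
rewrite -/P gerDl leNgt /cone subrr normr0 subr0 => bump_v.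
have : 0 < Num.max 0 (delta * rho) by rewrite lt_max mulr_gt0 ?orbT.
apply/negP/bump_v; exists C => y Xy; apply: (le_trans (bump_le y Xy)).
by rewrite lerD2l (le_trans (ler_norm _))// uC.
Qed.

End Envelope.

(** * The star of a vertex *)

Section Star.
Context {R : realType} {n : nat}.
Local Notation NR := 'rV[R]_n.
Local Notation dim := Defs.dim.
Implicit Types (X sigma e : set NR) (Pi : set (set NR)) (v : NR).

Lemma near_faces_through Pi v : polyhedral_complex Pi ->
  \forall y \near v, forall sigma, Pi sigma -> sigma y -> sigma v.
Proof.
move=> Pic; have [s Pis] := (finite_seqP _).1 (pc_finite Pic).
have : \forall y \near v, forall sigma, sigma \in s -> sigma y -> sigma v.
  apply: (@near_all_seq _ _ _ _ (fun sigma y => sigma y -> sigma v)).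
  move=> sigma ss; have [sv|nsv] := pselect (sigma v).
    by near=> y.
  have Pisigma : Pi sigma by rewrite Pis.
  have := rational_polyhedron_closed (pc_polyhedron Pic Pisigma) nsv.
  exact: filterS.
by apply: filterS => y sy sigma; rewrite Pis; exact: sy.
Unshelve. all: by end_near. Qed.

(** A face through [v] has dimension at most one: it is [set v] or an edge
    at [v]. *)
Lemma near_star X Pi v :
  one_dimensional X -> polyhedral_structure X Pi -> vertices Pi v ->
  \forall y \near v, X y -> y = v \/ exists2 e, edges_at Pi v e & e y.
Proof.
move=> X1 PiX Piv; have [Pic UPi] := PiX.
apply: filterS (near_faces_through v Pic) => y yv.
rewrite -UPi => -[sigma Pis sy]; have sv := yv _ Pis sy.
have := one_dimensional_dim_le1 X1 PiX Pis.
rewrite leq_eqVlt ltnS leqn0 => /orP[/eqP dim1|/eqP dim0]; [right|left].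
  exists sigma => //; split=> //.
  have vs : [set v] `&` sigma = [set v].
    by apply/seteqP; split=> [z []//|z ->]; split.
  have := pc_inter Pic Piv Pis; rewrite vs => -[v0|[]//].
  by have : [set v] v by []; rewrite v0.
by move: sy; rewrite (dim0_singleton dim0 sv).
Qed.

Lemma primitive_directionP v e : primitive_direction v e != 0 ->
  is_primitive_direction v e (primitive_direction v e).
Proof.
by rewrite /primitive_direction; case: xgetP => [p _ //|_]; rewrite eqxx.
Qed.

(** A linear form minimal on [e] exactly at [v] is positive on the primitive
    vector, so it forces the coordinate of a point of [e] to be nonnegative. *)
Lemma edge_in_ray v e x :
  dim e = 1%N -> face [set v] e -> primitive_direction v e != 0 -> e x ->
  exists2 t : R, 0 <= t & x = v + t *: ofZ (primitive_direction v e).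
Proof.
move=> dim1 vface /primitive_directionP [pe p0 _ [t0 t0_gt0 et0]] ex.
set p := primitive_direction v e in pe p0 et0 *.
have ev : e v by exact: (face_sub vface).
have [_ [f vE]] := vface.
have p0' : (ofZ p : NR) != 0 by apply: contra p0 => /eqP/ofZ_eq0 ->.
have fmin y : e y -> pairing f v <= pairing f y.
  by move=> ey; have : [set v] v by []; rewrite vE => -[_]; apply.
have fp : 0 < pairing f (ofZ p).
  rewrite lt_def -(pmulr_rge0 _ t0_gt0) -pairingZr.
  have := fmin _ et0; rewrite pairingDr lerDl => ->; rewrite andbT.
  apply/eqP => fp0.
  have : [set v] (v + t0 *: ofZ p).
    rewrite vE; split=> // y ey; rewrite pairingDr pairingZr fp0 mulr0 addr0.
    exact: fmin.
  move=> /= /eqP; rewrite -subr_eq0 addrAC subrr add0r scaler_eq0.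
  by rewrite (negbTE p0') gt_eqF.
have : x - v \in <[ofZ p : NR]>%VS.
  apply: (line_in_plane (D := dirspace e)) => //; last exact: dirspace_mem.
  by move: dim1; rewrite /Defs.dim => ->.
move=> /vlineP[t xv]; exists t; last by rewrite -xv addrC subrK.
have := fmin _ ex; rewrite -[x](subrK v) xv pairingDr pairingZr lerDr.
by rewrite pmulr_lge0.
Qed.

Lemma edge_rational_step v e :
  segment_closed e -> e v -> primitive_direction v e != 0 ->
  exists2 t : rat, 0 < t & e (v + ratr t *: ofZ (primitive_direction v e)).
Proof.
move=> eseg ev /primitive_directionP [_ _ _ [t0 t0_gt0 et0]].
have [q] := rat_in_itvoo t0_gt0; rewrite in_itv /= => /andP[q0 qt].
exists q; first by rewrite -(ltr0q R).
have -> : v + ratr q *: ofZ (primitive_direction v e) =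
    (1 - ratr q / t0) *: v +
    (ratr q / t0) *: (v + t0 *: ofZ (primitive_direction v e)).
  apply/rowP => i; rewrite !mxE; field; exact: lt0r_neq0.
apply: eseg => //.
by rewrite divr_ge0 ?(ltW q0) ?(ltW t0_gt0)//= ler_pdivrMr// mul1r ltW.
Qed.

Lemma edge_slope Pi (P : NR -> R) e v x (t : R) :
  PA_on Pi P -> Pi e -> e v -> e (v + t *: x) ->
  P (v + t *: x) = P v + t * pairing (ofQ (linear_part P e)) x.
Proof.
move=> [_ Paff] Pie ev ex; rewrite /linear_part.
case: xgetP => [m _ [c mc]|none]; last first.
  by have [m [c mc]] := Paff _ Pie; case: (none m); exists c.
by rewrite !mc// pairingDr pairingZr; ring.
Qed.

Lemma vertex_rational Pi v : polyhedral_complex Pi -> vertices Pi v ->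
  exists q, v = ofQ q.
Proof.
move=> Pic Piv.
have [q /= <- _] := rational_points_dense (pc_polyhedron Pic Piv) erefl filterT.
by exists q.
Qed.

End Star.

(** * Orthogonality *)

Section LocalMass.
Context {R : realType} {n : nat}.
Local Notation NR := 'rV[R]_n.

Lemma Zspan_row_space (r : nat) (N : 'I_r -> 'rV[int]_n)
    (B : set 'rV[int]_n) p :
  (forall q, B q -> exists i, q = N i) -> Zspan B p ->
  exists c, (ofZ p : NR) = c *m \matrix_i ofZ (N i).
Proof.
move=> BN [s [sB ->]]; apply/submxP.
elim: s sB => [|[k q] s IHs] sB.
  by rewrite big_nil ofZ0 sub0mx.
rewrite big_cons /=.
have [i qi] : exists i, q = N i.
  by apply: BN; apply: (sB (k, q)); rewrite inE eqxx.
have -> (x : 'rV[int]_n) : ofZ (k *: q + x) = k%:~R *: ofZ q + ofZ x :> NR.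
  by apply/rowP => j; rewrite !mxE intrD intrM.
apply: addmx_sub; last by apply: IHs => c cs; apply: sB; rewrite inE cs orbT.
apply: scalemx_sub; rewrite qi.
have -> : ofZ (N i) = row i (\matrix_i (ofZ (N i) : NR)) by rewrite rowK.
exact: row_sub.
Qed.

(** Away from the contact set the envelope carries no mass: at [v], a positive
    mass makes the envelope the sum of an affine function and of a multiple of
    the distance to [v], which [envelope_contact] excludes. *)
Lemma MA_mass_envelope_eq0 (X : set NR) (Pi0 : set (set NR))
    (w0 : set NR -> rat) (gamma u : NR -> R) Pi w v :
  one_dimensional X -> PC X gamma -> polyhedrally_smooth X Pi0 w0 ->
  PA X u -> bounded_on X u -> weight_on X Pi0 w0 Pi w ->
  PA_on Pi (envelope X gamma u) -> vertices Pi v ->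
  envelope X gamma u v < gamma v + u v ->
  MA_mass Pi w (envelope X gamma u) v = 0.
Proof.
move=> X1 PCgamma smooth PAu ubounded wPi PAP Piv vlt.
have [PiX [w_gt0 balance]] : balanced_structure X Pi w by case: wPi.
have [Pic UPi] := PiX.
set P := envelope X gamma u in PAP vlt *.
have Pcont : {within X, continuous P} by rewrite -UPi; case: PAP.
have PCP : PC X P := PC_envelope PCgamma ubounded Pcont.
have Xv : X v by rewrite -UPi; exists [set v].
have [vq vqE] := vertex_rational Pic Piv.
have [_ rankE] := smooth _ _ wPi _ Piv.
have finE : finite_set (edges_at Pi v).
  by apply: sub_finite_set (pc_finite Pic) => e [[]].
pose s : seq (set NR) := fset_set (edges_at Pi v).
pose r := size s.
pose e (i : 'I_r) : set NR := nth set0 s i.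
pose N (i : 'I_r) := primitive_direction v (e i).
have sE x : (x \in s) = (x \in edges_at Pi v) by exact: in_fset_set.
have eE i : edges_at Pi v (e i).
  by have := mem_nth set0 (ltn_ord i); rewrite sE inE.
have edge_index x : edges_at Pi v x -> exists i, x = e i.
  move=> /mem_set; rewrite -sE => /(nthP set0)[i ir <-].
  by exists (Ordinal ir).
have sum_edges (V : nmodType) (F : set NR -> V) :
    \sum_(x \in edges_at Pi v) F x = \sum_i F (e i).
  by rewrite fsbig_finite//= (big_nth set0) big_mkord.
have Pie i : Pi (e i) by have [[]] := eE i.
have dime i : Defs.dim (e i) = 1%N by have [[]] := eE i.
have ve i : face [set v] (e i) by have [] := eE i.
have ev i : e i v by exact: face_sub (ve i) _ erefl.
pose wR i : R := ratr (w (e i)).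
pose dir i : NR := ofZ (N i).
pose p i : R := pairing (ofQ (linear_part P (e i))) (dir i).
have wR0 i : 0 < wR i by rewrite ltr0q; apply: w_gt0; have [] := eE i.
have balanceR : \sum_i wR i *: dir i = 0.
  have := balance _ Piv; rewrite sum_edges => /rowP bal.
  apply/rowP => j; move: (congr1 (ratr : rat -> R) (bal j)).
  rewrite !mxE rmorph0 => <-; rewrite !summxE rmorph_sum.
  by apply: eq_bigr => i _; rewrite !mxE rmorphM /= ratr_int.
have massE : ratr (MA_mass Pi w P v) = \sum_i wR i * p i.
  rewrite /MA_mass sum_edges rmorph_sum; apply: eq_bigr => i _.
  by rewrite rmorphM /= /p /dir -ofQ_ofZ pairing_ofQ.
pose A : 'M[R]_(r, n) := \matrix_i dir i.
pose W : 'rV[R]_r := \row_i wR i.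
have WA : W *m A = 0.
  rewrite mulmx_sum_row -[RHS]balanceR; apply: eq_bigr => i _.
  by rewrite rowK mxE.
have [i0 _] : exists i0 : 'I_r, true.
  suff r0 : (0 < r)%N by exists (Ordinal r0).
  have -> : r = valency Pi v by [].
  by rewrite -rankE.
have W0 : W != 0.
  apply/eqP => /rowP /(_ i0); rewrite !mxE => wi0.
  by have := wR0 i0; rewrite wi0 ltxx.
have relation c : c *m A = 0 -> exists k, c = k *: W.
  apply: (relation_unique (S := (ofZ : _ -> NR) @`
    Zspan (primitive_direction v @` edges_at Pi v))) => //.
    move=> _ [q qL <-]; apply: Zspan_row_space qL => _ [x /edge_index[i ->] <-].
    by exists i.
  by move: rankE; rewrite /lattice_rank => ->.
apply: contrapT => mass_neq0.
(* A primitive vector equal to the default value 0 would make its edge the only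
   one at v, and the mass would vanish. *)
have N0 i : N i != 0.
  apply/eqP => Ni0; apply: mass_neq0.
  have iE j : j = i.
    apply: (zero_row_sole_index relation) => [m|].
      by rewrite mxE gt_eqF.
    by rewrite rowK /dir Ni0 ofZ0.
  suff : ratr (MA_mass Pi w P v) = 0 :> R.
    by move=> /eqP; rewrite fmorph_eq0 => /eqP.
  rewrite massE big1// => j _.
  by rewrite (iE j) /p /dir Ni0 ofZ0 pairing0r mulr0.
have slope i t : e i (v + t *: dir i) -> P (v + t *: dir i) = P v + t * p i.
  exact: (edge_slope PAP (Pie i) (ev i)).
have eseg i : segment_closed (e i).
  exact: rational_polyhedron_segment_closed (pc_polyhedron Pic (Pie i)).
have mass_ge0 : 0 <= \sum_i wR i * p i.
  have /choice[t tP] : forall i, exists t : rat,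
      0 < t /\ e i (v + ratr t *: dir i).
    move=> i; have [t] := edge_rational_step (eseg i) (ev i) (N0 i).
    by exists t.
  rewrite vqE in Piv ve tP slope *.
  apply: (PC_balanced_slopes_ge0 (N := N) PCP PiX Piv _ _ _ (t := t)) => //.
  - by move=> i; have [] := tP i.
  - by move=> i; have [] := tP i.
  - by move=> i; apply: slope; have [] := tP i.
have mass_gt0 : 0 < \sum_i wR i * p i.
  by rewrite lt_def mass_ge0 andbT -massE fmorph_eq0; apply/eqP.
have NR0 i : 0 < `|dir i|.
  by rewrite normr_gt0; apply: contra (N0 i) => /eqP/ofZ_eq0 ->.
(* The constant delta is chosen so that the weighted sum of the numbers
   p i - delta * |dir i| vanishes. *)
pose D := \sum_i wR i * `|dir i|.
have D0 : 0 < D.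
  rewrite /D (bigD1 i0)//=; apply: ltr_pwDl; first exact: mulr_gt0.
  by apply: sumr_ge0 => i _; apply/ltW/mulr_gt0.
pose delta := (\sum_i wR i * p i) / D.
have delta0 : 0 < delta by rewrite divr_gt0.
have [l lE] : exists l : NR, forall i,
    pairing l (dir i) = p i - delta * `|dir i|.
  pose b : 'cV[R]_r := \col_i (p i - delta * `|dir i|).
  have Wb : W *m b = 0.
    apply/colP => j; rewrite !mxE.
    under eq_bigr do rewrite !mxE mulrBr [_ * (delta * _)]mulrCA.
    by rewrite big_split /= sumrN -mulr_sumr /delta divfK ?subrr// gt_eqF.
  have [l Al] := relation_functional relation W0 WA Wb.
  exists l^T => i; have /colP/(_ i) := Al; rewrite [b i 0]mxE => <-.
  by rewrite pairing_mulmx trmxK -(rowK dir i) -row_mul mxE.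
have uc : {within X, continuous u} by case: PAu => Pi' [_ <-] [].
suff : gamma v + u v <= P v by rewrite leNgt vlt.
apply: (envelope_contact (c := P v - pairing l v) (l := l) PCgamma ubounded uc
  Pcont Xv delta0).
apply: filterS (near_star X1 PiX Piv) => y yv Xy.
have [->|[x /edge_index[i ->] ey]] := yv Xy.
  by rewrite -/P subrr normr0 mulr0; ring.
have [t t0 yE] := edge_in_ray (dime i) (ve i) (N0 i) ey.
rewrite -/P yE in ey *; rewrite slope// -/(dir i) pairingDr pairingZr lE.
by rewrite [v + _ - v]addrC addKr normrZ ger0_norm//; ring.
Qed.

End LocalMass.

Unset Implicit Arguments.

Theorem proposition6p21 (R : realType) (n : nat)
    (X : set 'rV[R]_n) (Pi0 : set (set 'rV[R]_n)) (w0 : set 'rV[R]_n -> rat)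
    (gamma : 'rV[R]_n -> R)
    (X_one_dimensional : one_dimensional X)
    (X_balanced : balanced_structure X Pi0 w0)
    (gamma_PAPC : PAPC X gamma)
    (gamma_positive : positive_at_infinity X gamma)
    (X_smooth : polyhedrally_smooth X Pi0 w0) :
  orthogonality_property X Pi0 w0 gamma.
Proof.
move=> u PAu ubounded Pi w wPi PAP.
rewrite /MA_integral fsbig1// => v Piv.
have [[Pic UPi] _] : balanced_structure X Pi w by case: wPi.
have Xv : X v by rewrite -UPi; exists [set v].
have := envelope_le gamma_PAPC.2 ubounded Xv.
rewrite le_eqVlt => /orP[/eqP ->|vlt]; first by rewrite subrr mulr0.
rewrite (MA_mass_envelope_eq0 X_one_dimensional gamma_PAPC.2 X_smooth PAu
  ubounded wPi PAP Piv vlt).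
by rewrite rmorph0 mul0r.
Qed.
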